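(* Let $R$ be a commutative ring with identity, $S$ a multiplicatively closed subset of $R$, $M$ a multiplication $R$-module, and $P$ a submodule of $M$ with $(P:_R M)\cap S=\emptyset$. Then the following are equivalent: (a) $P$ is an $S$-primary (resp. $S$-prime) submodule of $M$. (b) $(P:_R M)$ is an $S$-primary (resp. $S$-prime) ideal of $R$. (c) $P=IM$ for some $S$-primary (resp. $S$-prime) ideal $I$ of $R$ with $\mathrm{Ann}_R(M)\subseteq I$.
   Context: All rings are commutative with identity and all modules are unital. A multiplicatively closed subset $S$ of $R$ is a non-empty subset with $0\notin S$, $1\in S$, and $ss'\in S$ for all $s,s'\in S$. $(P:_R M)=\{r\in R : rM\subseteq P\}$, $\mathrm{Ann}_R(M)=(0:_R M)$, and $\sqrt{I}$ is the radical of an ideal $I$. A submodule $P$ of $M$ with $(P:_R M)\cap S=\emptyset$ is called $S$-primary (resp. $S$-prime) if there exists $s\in S$ such that whenever $rm\in P$ with $r\in R$, $m\in M$, then $sr\in\sqrt{(P:_R M)}$ (resp. $sr\in(P:_R M)$) or $sm\in P$. An ideal of $R$ is an $S$-primary (resp. $S$-prime) ideal if it is an $S$-primary (resp. $S$-prime) submodule of the $R$-module $R$. $M$ is a multiplication module if for every submodule $N$ of $M$ there is an ideal $I$ of $R$ with $N=IM$. *)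

(* Defs.v *)
From mathcomp Require Import all_boot all_algebra.
From mathcomp Require Import boolp classical_sets.

Set Implicit Arguments.
Unset Strict Implicit.
Unset Printing Implicit Defensive.

Import GRing.Theory.

Local Open Scope classical_set_scope.
Local Open Scope ring_scope.

Definition mult_closed (R : comPzRingType) (S : set R) : Prop :=
  [/\ S !=set0, ~ S 0, S 1 & forall s t, S s -> S t -> S (s * t)].

Definition submodule (R : comPzRingType) (M : lmodType R) (N : set M) : Prop :=
  GRing.submod_closed [in N].

(* Unlike [idealr_closed] of [ring_quotient], this allows the unit ideal. *)
Definition ideal (R : comPzRingType) (I : set R) : Prop :=
  submodule (I : set R^o).

(* The residual (P :_R M). *)
Definition colon (R : comPzRingType) (M : lmodType R) (P : set M) : set R :=
  [set r | forall m, P (r *: m)].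

Definition annihilator (R : comPzRingType) (M : lmodType R) : set R :=
  colon ([set 0] : set M).

Definition radical (R : comPzRingType) (I : set R) : set R :=
  [set r | exists2 n, (0 < n)%N & I (r ^+ n)].

(* The product I M: all finite sums of elements a *: m with a in I. *)
Definition ideal_smul (R : comPzRingType) (M : lmodType R) (I : set R) :
    set M :=
  [set x | exists n (a : 'I_n -> R) (m : 'I_n -> M),
     (forall i, I (a i)) /\ x = \sum_(i < n) a i *: m i].

Arguments ideal_smul {R} M I.

Definition multiplication_module (R : comPzRingType) (M : lmodType R) : Prop :=
  forall N : set M, submodule N ->
    exists I : set R, ideal I /\ N = ideal_smul M I.

Definition S_primary (R : comPzRingType) (M : lmodType R)
    (S : set R) (P : set M) : Prop :=
  [/\ submodule P, colon P `&` S = set0 &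
    exists2 s, S s & forall (r : R) (m : M), P (r *: m) ->
      radical (colon P) (s * r) \/ P (s *: m)].

Definition S_prime (R : comPzRingType) (M : lmodType R)
    (S : set R) (P : set M) : Prop :=
  [/\ submodule P, colon P `&` S = set0 &
    exists2 s, S s & forall (r : R) (m : M), P (r *: m) ->
      colon P (s * r) \/ P (s *: m)].

Definition S_primary_ideal (R : comPzRingType) (S I : set R) : Prop :=
  S_primary S (I : set R^o).

Definition S_prime_ideal (R : comPzRingType) (S I : set R) : Prop :=
  S_prime S (I : set R^o).

(* Main.v *)
Require Import Defs.
From mathcomp Require Import all_boot all_algebra.
From mathcomp Require Import boolp classical_sets.

Set Implicit Arguments.
Unset Strict Implicit.
Unset Printing Implicit Defensive.

Import GRing.Theory.

Local Open Scope classical_set_scope.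
Local Open Scope ring_scope.

(** The substantial implication is (c) => (a).  Suppose [a x] lies in [I M]
    and [a] is not in the radical up to [s].  Call [c] good if [c M] is
    contained in a cyclic submodule [R m].  Writing [c x = t m], we have
    [a t m] in [c I M <= I m], whence [c a t] is in [I] because [Ann M <= I];
    so [s c t] is in [I] and [c^2] is in [K := (I M : s x)].  In a
    multiplication module [x = theta x] for some sum [theta] of multiples of
    good elements: [R x = J M] and each [y] in [M] lies in [(R y : M) M].
    Hence [theta] is in the radical of [K] while [1 - theta] is in [K], which
    forces [1] in [K], i.e. [s x] in [I M].  *)

(** * Submodules, ideals, residuals and products [I M] *)

Lemma submoduleP (R : comPzRingType) (M : lmodType R) (N : set M) :
  submodule N <->
  [/\ N 0, forall x y, N x -> N y -> N (x + y)
         & forall a x, N x -> N (a *: x)].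
Proof.
split=> [[N0 NZD] | [N0 ND NZ]].
  have {}N0 : N 0 by exact/set_mem.
  have {}NZD a x y : N x -> N y -> N (a *: x + y).
    by move=> Nx Ny; apply/set_mem/NZD; exact: mem_set.
  split=> // [x y Nx Ny | a x Nx].
    by rewrite -[x]scale1r; exact: NZD.
  by rewrite -[a *: x]addr0; exact: NZD.
split; first exact: mem_set.
by move=> a x y /set_mem Nx /set_mem Ny; apply: mem_set; apply: ND; first exact: NZ.
Qed.

Lemma idealP (R : comPzRingType) (I : set R) :
  ideal I <->
  [/\ I 0, forall x y, I x -> I y -> I (x + y) & forall a x, I x -> I (a * x)].
Proof. exact: submoduleP. Qed.

Lemma ideal_colon (R : comPzRingType) (M : lmodType R) (P : set M) :
  submodule P -> ideal (colon P).
Proof.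
move=> /submoduleP [P0 PD PZ]; apply/idealP; split.
- by move=> m; rewrite scale0r.
- by move=> x y Px Py m; rewrite scalerDl; apply: PD.
- by move=> a x Px m; rewrite -scalerA; apply: PZ.
Qed.

(** Lets the residual in the definition of an S-primary or S-prime ideal be replaced by the ideal
    itself. *)
Lemma colon_regular (R : comPzRingType) (I : set R) :
  ideal I -> colon (I : set R^o) = I.
Proof.
move=> /idealP [_ _ IM]; apply/seteqP; split=> [r Ir | r Ir m].
  by rewrite -[r]mulr1; exact: Ir.
by have := IM m r Ir; rewrite mulrC.
Qed.

Lemma ideal_smul_ind (R : comPzRingType) (M : lmodType R) (I : set R)
    (N : set M) :
  N 0 -> (forall x y, N x -> N y -> N (x + y)) ->
  (forall a m, I a -> N (a *: m)) -> ideal_smul M I `<=` N.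
Proof.
move=> N0 ND NZ x [n [a [m [Ia ->]]]].
by apply: big_ind => // i _; apply: NZ.
Qed.

Lemma mem_ideal_smul (R : comPzRingType) (M : lmodType R) (I : set R) a m :
  I a -> ideal_smul M I (a *: m).
Proof.
move=> Ia; exists 1%N, (fun=> a), (fun=> m); split=> //.
by rewrite big_ord1.
Qed.

Lemma submodule_ideal_smul (R : comPzRingType) (M : lmodType R) (I : set R) :
  submodule (ideal_smul M I).
Proof.
have IM0 : ideal_smul M I 0.
  by exists 0%N, (fun=> 0), (fun=> 0); split=> [[]|]; rewrite ?big_ord0.
have IMD x y : ideal_smul M I x -> ideal_smul M I y -> ideal_smul M I (x + y).
  move=> [n [a [m [Ia ->]]]] [n' [a' [m' [Ia' ->]]]].
  (* The two families are concatenated: [split] tells which half of the index range [i] falls in. *)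
  exists (n + n')%N,
    (fun i => match split i with inl j => a j | inr k => a' k end),
    (fun i => match split i with inl j => m j | inr k => m' k end).
  split=> [i | ]; first by case: (split i).
  rewrite big_split_ord /=; congr (_ + _); apply: eq_bigr => i _.
    by case: split_ordP => j /eqP; rewrite (eq_lrshift, eq_lshift) // => /eqP ->.
  by case: split_ordP => j /eqP; rewrite (eq_rlshift, eq_rshift) // => /eqP ->.
apply/submoduleP; split=> // b; apply: ideal_smul_ind => [||a m Ia].
- by rewrite scaler0.
- by move=> x y; rewrite scalerDr; apply: IMD.
- by rewrite scalerA mulrC -scalerA; apply: mem_ideal_smul.
Qed.

(** If [P = I M] then [I] lies in [(P : M)], so [P = I M <= (P : M) M <= P]. *)
Lemma colon_ideal_smul (R : comPzRingType) (M : lmodType R) (P : set M) :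
  multiplication_module M -> submodule P -> P = ideal_smul M (colon P).
Proof.
move=> hM hP; have [I [_ PIM]] := hM P hP.
have IP : I `<=` colon P by move=> a Ia m; rewrite PIM; exact: mem_ideal_smul.
apply/seteqP; split.
  by rewrite {1}PIM => x [n [a [m [Ia ->]]]]; exists n, a, m; split=> // i; exact/IP.
have /submoduleP [P0 PD _] := hP.
by apply: ideal_smul_ind => // a m; exact.
Qed.

Lemma ideal_radical (R : comPzRingType) (I : set R) :
  ideal I -> ideal (radical I).
Proof.
move=> /idealP [I0 ID IM]; apply/idealP; split.
- by exists 1%N.
- move=> x y [n n0 Ix] [m m0 Iy]; exists (n + m)%N; first by rewrite addn_gt0 n0.
  rewrite exprDn; apply: big_ind => // i _; rewrite -mulr_natl; apply/IM.
  (* In the term [x^(n+m-i) y^i], either [i >= m] and [y^m] divides it, or [n+m-i >= n] and [x^n]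
     does. *)
  have [le_mi | lt_im] := leqP m i.
    by apply/IM; rewrite -(subnK le_mi) exprD; apply/IM.
  rewrite mulrC; apply/IM; rewrite -addnBA ?(ltnW lt_im) // addnC exprD.
  exact: IM.
- by move=> a x [n n0 Ix]; exists n; rewrite // exprMn; apply/IM.
Qed.

(** * Cyclic submodules and cancellation in multiplication modules *)

Definition cyclic_submodule (R : comPzRingType) (M : lmodType R) (x : M) :
  set M := [set a *: x | a in setT].

Lemma submodule_cyclic (R : comPzRingType) (M : lmodType R) (x : M) :
  submodule (cyclic_submodule x).
Proof.
apply/submoduleP; split.
- by exists 0; rewrite ?scale0r.
- by move=> _ _ [a _ <-] [b _ <-]; exists (a + b); rewrite ?scalerDl.
- by move=> b _ [a _ <-]; exists (b * a); rewrite ?scalerA.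
Qed.

Lemma mem_cyclic_submodule (R : comPzRingType) (M : lmodType R) (x : M) :
  cyclic_submodule x x.
Proof. by exists 1; rewrite ?scale1r. Qed.

Lemma mem_colon_cyclic_smul (R : comPzRingType) (M : lmodType R) (x : M) :
  multiplication_module M -> ideal_smul M (colon (cyclic_submodule x)) x.
Proof.
move=> hM; rewrite -colon_ideal_smul //; first exact: mem_cyclic_submodule.
exact: submodule_cyclic.
Qed.

(* That is, [x] is in [T x] for the sum [T] of the ideals [(R m : M)]. *)
Lemma multiplication_module_fixes (R : comPzRingType) (M : lmodType R)
    (T : set R) (x : M) :
  multiplication_module M -> ideal T ->
  (forall m : M, colon (cyclic_submodule m) `<=` T) ->
  exists2 t, T t & x = t *: x.
Proof.
move=> hM /idealP [T0 TD TM] hT.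
pose N := [set z : M | exists2 t, T t & z = t *: x].
have N0 : N 0 by exists 0; rewrite ?scale0r.
have ND y z : N y -> N z -> N (y + z).
  by move=> [t Tt ->] [u Tu ->]; exists (t + u); rewrite ?scalerDl //; exact: TD.
(* Two expansions: [x] lies in [(R x : M) M], and each [y] occurring there lies in [(R y : M) M],
   whose coefficients are in [T]. *)
suff jN j y : colon (cyclic_submodule x) j -> N (j *: y).
  exact: (ideal_smul_ind N0 ND jN (mem_colon_cyclic_smul x hM)).
move=> jx; move: (mem_colon_cyclic_smul y hM).
have : ideal_smul M (colon (cyclic_submodule y)) `<=` [set z | N (j *: z)].
  apply: ideal_smul_ind => /= [|u v|c z cy].
  - by rewrite scaler0.
  - by rewrite scalerDr; exact: ND.
  - have [u _ jz] := jx z; exists (u * c); first exact/TM/(hT y).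
    by rewrite scalerA mulrC -scalerA -jz scalerA mulrC.
exact.
Qed.

(* [Q] stands for [s a \in I] or for [s a \in sqrt I]. *)
Lemma ideal_smul_cancel (R : comPzRingType) (M : lmodType R) (I Q : set R)
    (s : R) :
  multiplication_module M -> ideal I -> annihilator M `<=` I ->
  (forall a b, I (a * b) -> Q a \/ I (s * b)) ->
  forall a (x : M), ideal_smul M I (a *: x) ->
    Q a \/ ideal_smul M I (s *: x).
Proof.
move=> hM hI hann hQ a x IMax.
have [Qa | nQa] := pselect (Q a); [by left | right].
have /submoduleP [IM0 IMD IMZ] := submodule_ideal_smul M I.
have /idealP [I0 ID IM] := hI.
pose K := [set r : R | ideal_smul M I (r *: (s *: x))].
have hK : ideal K.
  apply/idealP; split; rewrite /K /=; first by rewrite scale0r.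
    by move=> r r' Kr Kr'; rewrite scalerDl; exact: IMD.
  by move=> b r Kr; rewrite -scalerA; exact: IMZ.
have goodK (m : M) : colon (cyclic_submodule m) `<=` radical K.
  (* Exponent 2: one factor [c] turns [x] into [t *: m], the other brings [s * t] into [I]. *)
  move=> c cm; exists 2%N => //.
  have [t _ cx] := cm x.
  have [p Ip cax] : exists2 p, I p & c *: (a *: x) = p *: m.
    move: (a *: x) IMax; apply: ideal_smul_ind => [|y z|b y Ib].
    - by exists 0; rewrite ?scale0r ?scaler0.
    - move=> [p Ip py] [q Iq qz]; exists (p + q); first exact: ID.
      by rewrite scalerDr scalerDl py qz.
    - have [u _ cy] := cm y; exists (u * b); first exact: IM.
      by rewrite scalerA mulrC -scalerA -cy scalerA mulrC.
  have atm : (a * t) *: m = p *: m.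
    by rewrite -scalerA cx -cax !scalerA mulrC.
  (* [a * t - p] kills [m] and [c] maps [M] into [R m], so the product annihilates [M]. *)
  have Icatp : I (c * (a * t - p)).
    apply: hann => y /=; have [u _ cy] := cm y.
    rewrite mulrC -scalerA -cy scalerA mulrC -scalerA scalerBl atm subrr.
    exact: scaler0.
  have Iact : I (a * (c * t)).
    rewrite (_ : a * _ = c * (a * t - p) + c * p); last first.
      by rewrite -mulrDr subrK mulrCA.
    by apply: ID => //; exact: IM.
  have [//|Isct] := hQ _ _ Iact.
  rewrite /K /= (_ : _ *: _ = (s * (c * t)) *: m); first exact: mem_ideal_smul.
  by rewrite expr2 -!scalerA cx !scalerA mulrC mulrA.
have [t [n n0 Ktn] xt] :=
  multiplication_module_fixes x hM (ideal_radical hK) goodK.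
(* Iterating [x = t *: x] reaches the power of [t] known to lie in [K]; it fixes [s *: x], which is
   therefore in [I M]. *)
have {}xt : t ^+ n *: x = x.
  by elim: n {n0 Ktn} => [|n IHn]; rewrite ?scale1r // exprSr -scalerA -xt.
by move: Ktn; rewrite /K /= scalerA mulrC -scalerA xt.
Qed.

(** * Transfer between [P], its residual and [I M] *)

Lemma S_primary_colon (R : comPzRingType) (S : set R) (M : lmodType R)
    (P : set M) :
  S_primary S P -> S_primary_ideal S (colon P).
Proof.
move=> [hP PS [s Ss hs]]; have hI := ideal_colon hP.
split; rewrite ?colon_regular //; exists s => // r b Prb.
(* The case split comes before [m] is chosen, since one alternative must serve all [m]; the
   hypothesis is then applied to [r] and [b *: m]. *)
have [sr | nsr] := pselect (radical (colon P) (s * r)); [by left | right=> m].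
have := Prb m; rewrite -scalerA => /hs [//|].
by rewrite scalerA.
Qed.

Lemma S_prime_colon (R : comPzRingType) (S : set R) (M : lmodType R)
    (P : set M) :
  S_prime S P -> S_prime_ideal S (colon P).
Proof.
move=> [hP PS [s Ss hs]]; have hI := ideal_colon hP.
split; rewrite ?colon_regular //; exists s => // r b Prb.
have [sr | nsr] := pselect (colon P (s * r)); [by left | right=> m].
have := Prb m; rewrite -scalerA => /hs [//|].
by rewrite scalerA.
Qed.

Lemma annihilator_sub_colon (R : comPzRingType) (M : lmodType R) (P : set M) :
  submodule P -> annihilator M `<=` colon P.
Proof. by move=> /submoduleP [P0 _ _] r r0 m; have /= -> := r0 m. Qed.

Lemma sub_colon_ideal_smul (R : comPzRingType) (M : lmodType R) (I : set R) :
  I `<=` colon (ideal_smul M I).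
Proof. by move=> r Ir m; exact: mem_ideal_smul. Qed.

Lemma S_primary_ideal_smul (R : comPzRingType) (S : set R) (M : lmodType R)
    (I : set R) :
  multiplication_module M -> colon (ideal_smul M I) `&` S = set0 ->
  S_primary_ideal S I -> annihilator M `<=` I ->
  S_primary S (ideal_smul M I).
Proof.
move=> hM PS [hI _ [s Ss]]; rewrite colon_regular // => hs hann.
split=> //; first exact: submodule_ideal_smul.
exists s => // r m /(ideal_smul_cancel hM hI hann hs) [[n n0 Isr]|]; last by right.
(* The exponent is kept, because [I] lies in [(I M : M)]. *)
by left; exists n => //; exact: sub_colon_ideal_smul.
Qed.

Lemma S_prime_ideal_smul (R : comPzRingType) (S : set R) (M : lmodType R)
    (I : set R) :
  multiplication_module M -> colon (ideal_smul M I) `&` S = set0 ->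
  S_prime_ideal S I -> annihilator M `<=` I ->
  S_prime S (ideal_smul M I).
Proof.
move=> hM PS [hI _ [s Ss]]; rewrite colon_regular // => hs hann.
split=> //; first exact: submodule_ideal_smul.
exists s => // r m /(ideal_smul_cancel hM hI hann hs) [Isr|]; last by right.
by left; exact: sub_colon_ideal_smul.
Qed.

Theorem theorem2p17 (R : comPzRingType) (S : set R) (M : lmodType R)
    (P : set M) (hS : mult_closed S) (hM : multiplication_module M)
    (hP : submodule P) (hPS : colon P `&` S = set0) :
  [<-> S_primary S P;
       S_primary_ideal S (colon P);
       exists I : set R,
         [/\ S_primary_ideal S I, annihilator M `<=` I & P = ideal_smul M I]]
  /\
  [<-> S_prime S P;
       S_prime_ideal S (colon P);
       exists I : set R,
         [/\ S_prime_ideal S I, annihilator M `<=` I & P = ideal_smul M I]].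
Proof.
split; tfae.
- exact: S_primary_colon.
- move=> hI; exists (colon P).
  by split=> //; [exact: annihilator_sub_colon | exact: colon_ideal_smul].
(* Rewriting [hPS] supplies the disjointness of [(I M : M)], which may be larger than [I], from
   [S]. *)
- move=> [I [hI hann PIM]]; rewrite PIM in hPS *.
  exact: S_primary_ideal_smul.
- exact: S_prime_colon.
- move=> hI; exists (colon P).
  by split=> //; [exact: annihilator_sub_colon | exact: colon_ideal_smul].
- move=> [I [hI hann PIM]]; rewrite PIM in hPS *.
  exact: S_prime_ideal_smul.
Qed.
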